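(* Let $n\ge 1$ and let $\mathbf M,\mathbf X,\mathbf Y$ be real symmetric positive definite $n\times n$ matrices. Then $$d_{\rm gbw}(\mathbf X,\mathbf Y)=\min_{\mathbf O\in O(n)}\|\mathbf X^{1/2}-\mathbf Y^{1/2}\mathbf O\|_{\mathbf M^{-1}},$$ where $O(n)$ is the group of real orthogonal $n\times n$ matrices.
   Context: For a matrix $\mathbf B$ that is a product of two symmetric positive definite matrices, $\mathbf B^{1/2}$ denotes its principal square root (the unique square root with positive eigenvalues). For symmetric positive definite $\mathbf M$, the generalized Bures-Wasserstein (GBW) distance is $$d_{\rm gbw}(\mathbf X,\mathbf Y)=\sqrt{\operatorname{tr}(\mathbf M^{-1}\mathbf X)+\operatorname{tr}(\mathbf M^{-1}\mathbf Y)-2\operatorname{tr}\big((\mathbf X\mathbf M^{-1}\mathbf Y\mathbf M^{-1})^{1/2}\big)}.$$ The Mahalanobis norm of $\mathbf Z\in\mathbb R^{n\times n}$ is $\|\mathbf Z\|_{\mathbf M^{-1}}=\sqrt{\operatorname{tr}(\mathbf Z^\top\mathbf M^{-1}\mathbf Z)}$. *)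

(* Defs.v *)
From HB Require Import structures.
From mathcomp Require Import all_boot all_order all_algebra.
From mathcomp Require Import complex.
From mathcomp Require Import boolp classical_sets reals.

Set Implicit Arguments.
Unset Strict Implicit.
Unset Printing Implicit Defensive.

Import Order.TTheory GRing.Theory Num.Theory.

Local Open Scope classical_set_scope.
Local Open Scope ring_scope.

Section GBW.
Context {R : rcfType} {n : nat}.
Implicit Types A B M S X Y Z : 'M[R]_n.

Definition spdmx A : Prop :=
  A \is symmetricmx /\
  forall v : 'cV[R]_n, v != 0 -> 0 < (v^T *m A *m v) 0 0.

(* The eigenvalues of S are taken in R[i]; in the order of R[i], 0 < z means
   that z is real and positive. *)
Definition principal_sqrtmx B S : Prop :=
  S *m S = B /\
  forall z : R[i], eigenvalue (map_mx (real_complex R) S) z -> 0 < z.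

(* B^{1/2}: meaningful when B is a product of two symmetric positive definite
   matrices, in which case the principal square root exists and is unique;
   0 if B has no principal square root. *)
Definition sqrtmx B : 'M[R]_n := xget 0 [set S | principal_sqrtmx B S].

Definition gbw_dist M X Y : R :=
  Num.sqrt (\tr (invmx M *m X) + \tr (invmx M *m Y)
            - 2 * \tr (sqrtmx (X *m invmx M *m Y *m invmx M))).

(* The norm || Z ||_{M^-1}; the argument is M, not M^-1. *)
Definition mahalanobis_norm M Z : R := Num.sqrt (\tr (Z^T *m invmx M *m Z)).

Definition orthogonal_group : set 'M[R]_n := [set O | O^T *m O = 1%:M].

End GBW.

Arguments orthogonal_group R n : clear implicits.

Definition is_minimum {R : rcfType} (A : set R) (m : R) : Prop :=
  A m /\ lbound A m.

(* Main.v *)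
(* Write A = X^{1/2}, C = Y^{1/2}, W = M^{-1} and K = A W C.  Expanding the
   square, || A - C O ||_W^2 = tr (W X) + tr (W Y) - 2 tr (K O), and by the polar
   decomposition of K the maximum of tr (K O) over O(n) is tr ((K K^T)^{1/2}).
   Since X W Y W = A (K K^T) A^{-1}, its principal square root is
   A (K K^T)^{1/2} A^{-1}, which has the same trace. *)
Require Import Defs.
From mathcomp Require Import all_boot all_order all_algebra.
From mathcomp Require Import complex lra.
From mathcomp Require Import boolp classical_sets reals.

Set Implicit Arguments.
Unset Strict Implicit.
Unset Printing Implicit Defensive.

Import Order.TTheory GRing.Theory Num.Theory.

Local Open Scope classical_set_scope.
Local Open Scope ring_scope.

Lemma symmetricmxP (F : fieldType) n (A : 'M[F]_n) :
  (A \is symmetricmx) <-> A^T = A.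
Proof.
rewrite qualifE/= expr0 scale1r map_mx_id//.
by split=> [/eqP<-|->].
Qed.

(** * Diagonalization of real symmetric matrices and principal roots of diagonalizable matrices *)

Section RealDiagonalization.
Context {R : rcfType} {n : nat}.
Implicit Types (A N P S : 'M[R]_n) (d : 'rV[R]_n).

Let toC := real_complex R.

Let map_Re_real (A : 'M[R[i]]_n) : A \is a mxOver Num.real ->
  A = map_mx toC (map_mx (@complex.Re R) A).
Proof.
move=> /mxOverP Areal; apply/matrixP => i j; rewrite !mxE.
by rewrite /toC RRe_real.
Qed.

(* Unitary diagonalization over R[i] has a real diagonal, and real matrices that
   are similar over R[i] are similar over R; P need not be orthogonal. *)
Lemma symmetric_diag A : A \is symmetricmx ->
  exists2 P : 'M[R]_n, P \in unitmx & exists d, A = invmx P *m diag_mx d *m P.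
Proof.
move=> Asym; set AC := map_mx toC A.
have ACreal : AC \is a mxOver Num.real.
  by apply/mxOverP => i j; rewrite mxE; apply/complex_realP; exists (A i j).
have ACsym : AC \is symmetricmx.
  by apply/symmetricmxP; rewrite map_trmx; congr map_mx; apply/symmetricmxP.
have ACherm := realsym_hermsym ACsym ACreal.
have ACdiag := orthomx_spectralP (hermitian_normalmx ACherm).
have dreal := hermitian_spectral_diag_real ACherm.
set Q := spectralmx AC in ACdiag; set D := spectral_diag AC in ACdiag dreal.
have Qunit : Q \in unitmx := spectral_unit _.
have Dreal : diag_mx D \is a mxOver Num.real.
  apply/mxOverP => i j; rewrite mxE.
  by case: eqP => _; rewrite ?mulr1n ?(mxOverP dreal) // mulr0n real0.
have [|P] := @real_similar _ _ AC (diag_mx D) _ ACreal Dreal.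
  exists Q => //; apply/similarP => //.
  by rewrite [in LHS]ACdiag !mulmxA mulmxV // mul1mx.
rewrite inE => /andP[/= Preal Punit] /(similarP Punit) PA.
rewrite (map_Re_real Preal) in PA Punit.
rewrite (map_Re_real Dreal) -!map_mxM in PA.
rewrite map_unitmx in Punit.
move/(@map_mx_inj _ _ toC): PA => PA.
exists (map_mx (@complex.Re R) P) => //; exists (map_mx (@complex.Re R) D).
have -> : diag_mx (map_mx (@complex.Re R) D) = map_mx (@complex.Re R) (diag_mx D).
  apply/matrixP => i j; rewrite !mxE.
  by case: eqP => _; rewrite ?mulr1n ?mulr0n.
by rewrite -mulmxA -PA mulKmx.
Qed.

(** The rows of [P] are left eigenvectors of [A], so the quadratic form of [A] at row i of [P]
    equals d_i times the squared Euclidean norm of that row, which forces d_i > 0. *)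
Lemma spdmx_diag A : spdmx A ->
  exists2 P : 'M[R]_n, P \in unitmx & exists2 d : 'rV[R]_n, (forall i, 0 < d 0 i) &
    A = invmx P *m diag_mx d *m P.
Proof.
case=> /symmetric_diag[P Punit [d Ad]] Apos; exists P => //; exists d => // i.
have rowP_neq0 : row i P != 0.
  rewrite rowE mulmx_free_eq0 ?row_free_unit //; apply/eqP => /matrixP/(_ 0 i).
  by rewrite !mxE !eqxx => /eqP; rewrite oner_eq0.
have : 0 < ((row i P)^T^T *m A *m (row i P)^T) 0 0.
  by apply: Apos; rewrite trmx_eq0.
have -> : (row i P)^T^T *m A = d 0 i *: row i P.
  rewrite trmxK rowE Ad !mulmxA mulmxK // -rowE row_diag_mx.
  by rewrite -scalemxAl.
rewrite -scalemxAl [X in 0 < X]mxE; set s := (_ *m _) 0 0.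
have : 0 <= s by rewrite /s mxE sumr_ge0 // => j _; rewrite !mxE -expr2 sqr_ge0.
rewrite le_eqVlt => /orP[/eqP <-|s_gt0]; first by rewrite mulr0 ltxx.
by rewrite pmulr_lgt0.
Qed.

(** If v is a left eigenvector over [R[i]] of the candidate root, then v P^{-1} is one of the
    diagonal matrix, and any nonzero coordinate i of it identifies the eigenvalue as d_i. *)
Lemma principal_sqrtmx_diag P d : P \in unitmx -> (forall i, 0 < d 0 i) ->
  principal_sqrtmx (invmx P *m diag_mx (map_mx (fun x => x ^+ 2) d) *m P)
    (invmx P *m diag_mx d *m P).
Proof.
move=> Punit dgt0; split.
  rewrite !mulmxA mulmxK // -[X in X *m P]mulmxA mulmx_diag.
  by do 3 f_equal; apply/rowP => i; rewrite !mxE expr2.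
move=> z /eigenvalueP[v].
rewrite !map_mxM map_invmx map_diag_mx.
set PC := map_mx _ P; have PCunit : PC \in unitmx by rewrite map_unitmx.
move=> /(congr1 (mulmx^~ (invmx PC))).
rewrite !mulmxA mulmxK // -scalemxAl.
move=> udiag v_neq0; have : v *m invmx PC != 0.
  by rewrite mulmx_free_eq0 ?row_free_unit ?unitmx_inv.
move: (v *m invmx PC) udiag => u /rowP udiag /rV0Pn[i ui_neq0].
have := udiag i; rewrite mul_mx_diag !mxE mulrC => /(mulIf ui_neq0) <-.
by rewrite ltcR.
Qed.

(* With T the diagonalizable root, Z = S - T satisfies T Z = - Z S, so a nonzero
   row of P Z would be an eigenvector of S for a negative eigenvalue - d_i. *)
Lemma principal_sqrtmx_diag_uniq P d S :
    P \in unitmx -> (forall i, 0 < d 0 i) ->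
    principal_sqrtmx (invmx P *m diag_mx (map_mx (fun x => x ^+ 2) d) *m P) S ->
  S = invmx P *m diag_mx d *m P.
Proof.
move=> Punit dgt0 [SS Spos].
have [TT _] := principal_sqrtmx_diag Punit dgt0.
set T := invmx P *m diag_mx d *m P in TT *.
apply/eqP; rewrite -subr_eq0 -(mulKmx Punit (S - T)).
suff -> : P *m (S - T) = 0 by rewrite mulmx0.
have ZS : (P *m (S - T)) *m S = - (diag_mx d *m (P *m (S - T))).
  have -> : diag_mx d *m (P *m (S - T)) = P *m (T *m (S - T)).
    by rewrite /T !mulmxA mulmxV // mul1mx.
  rewrite -mulmxA -[RHS]mulmxN; congr (_ *m _).
  by rewrite mulmxBl mulmxBr opprB SS TT.
apply/row_matrixP => i; rewrite row0; apply/eqP/negP => /negP Zi_neq0.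
have /Spos : eigenvalue (map_mx toC S) (toC (- d 0 i)).
  rewrite -[_ (toC _)]/(_ \in eigenvalue _).
  apply/eigenvalueP; exists (map_mx toC (row i (P *m (S - T)))).
    rewrite -map_mxM -map_mxZ -row_mul ZS; congr map_mx.
    by apply/rowP => j; rewrite mul_diag_mx !mxE mulNr.
  by rewrite map_mx_eq0.
by rewrite ltcR oppr_gt0 ltNge ltW.
Qed.

Lemma sqrtmx_diag P d : P \in unitmx -> (forall i, 0 < d 0 i) ->
  sqrtmx (invmx P *m diag_mx (map_mx (fun x => x ^+ 2) d) *m P)
  = invmx P *m diag_mx d *m P.
Proof.
move=> Punit dgt0; apply: principal_sqrtmx_diag_uniq => //.
(* A principal root exists, so [xget] returns one rather than its default 0. *)
apply: (@xgetPex _ _ [set S | principal_sqrtmx _ S]).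
by exists (invmx P *m diag_mx d *m P); exact: principal_sqrtmx_diag.
Qed.

(* The transpose of the root is again a principal root, so uniqueness applies. *)
Lemma symmetric_sqrt_diag P d : P \in unitmx -> (forall i, 0 < d 0 i) ->
  invmx P *m diag_mx (map_mx (fun x => x ^+ 2) d) *m P \is symmetricmx ->
  invmx P *m diag_mx d *m P \is symmetricmx.
Proof.
move=> Punit dgt0 /symmetricmxP Nsym; apply/symmetricmxP.
have trD e : (invmx P *m diag_mx e *m P)^T
    = invmx (invmx P^T) *m diag_mx e *m invmx P^T.
  by rewrite !trmx_mul tr_diag_mx trmx_inv invmxK mulmxA.
apply: principal_sqrtmx_diag_uniq => //; rewrite -Nsym !trD.
by apply: principal_sqrtmx_diag => //; rewrite unitmx_inv unitmx_tr.
Qed.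

End RealDiagonalization.

(** * Positive definite matrices, their square roots, and the maximal trace over O(n) *)

Section PositiveDefinite.
Context {R : rcfType} {n : nat}.
Implicit Types (A H K N O Z : 'M[R]_n).

Lemma spdmx1 : spdmx (1%:M : 'M[R]_n).
Proof.
split=> [|v v_neq0]; first by apply/symmetricmxP; rewrite trmx1.
have /rV0Pn[i vi_neq0] : v^T != 0 by rewrite trmx_eq0.
rewrite mulmx1 mxE (bigD1 i) //= ltr_wpDr //.
  by apply: sumr_ge0 => j _; rewrite mxE -expr2 sqr_ge0.
by rewrite !mxE in vi_neq0 *; rewrite -expr2 exprn_even_gt0.
Qed.

Lemma spdmx_congr K N : K \in unitmx -> spdmx N -> spdmx (K *m N *m K^T).
Proof.
move=> Kunit [/symmetricmxP Nsym Npos]; split.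
  by apply/symmetricmxP; rewrite !trmx_mul trmxK Nsym mulmxA.
move=> v v_neq0.
have -> : v^T *m (K *m N *m K^T) *m v = (K^T *m v)^T *m N *m (K^T *m v).
  by rewrite trmx_mul trmxK !mulmxA.
apply: Npos; rewrite -trmx_eq0 trmx_mul trmxK.
by rewrite mulmx_free_eq0 ?trmx_eq0 // row_free_unit.
Qed.

Lemma spdmx_unit N : spdmx N -> N \in unitmx.
Proof.
move=> /spdmx_diag[P Punit [d dgt0 ->]].
rewrite !unitmx_mul unitmx_inv Punit andbT /= unitmxE det_diag unitfE.
by apply/prodf_neq0 => i _; rewrite gt_eqF.
Qed.

Lemma spdmx_inv N : spdmx N -> spdmx (invmx N).
Proof.
move=> Nspd; have Nunit := spdmx_unit Nspd.
have /symmetricmxP Nsym := Nspd.1.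
have -> : invmx N = invmx N *m N *m (invmx N)^T.
  by rewrite mulVmx // mul1mx trmx_inv Nsym.
by apply: spdmx_congr => //; rewrite unitmx_inv.
Qed.

(** The diagonal entries are the values of the quadratic form of [N] at the columns of [Z]. *)
Lemma spdmx_trace_ge0 N Z : spdmx N -> 0 <= \tr (Z^T *m N *m Z).
Proof.
move=> [_ Npos]; apply: sumr_ge0 => i _.
have -> : (Z^T *m N *m Z) i i = ((col i Z)^T *m N *m col i Z) 0 0.
  rewrite tr_col -row_mul; move: (Z^T *m N) => B.
  by rewrite !mxE; apply: eq_bigr => j _; rewrite !mxE.
by have [->|/Npos/ltW//] := eqVneq (col i Z) 0; rewrite mulmx0 mxE.
Qed.

(** The conjugation clause serves products such as X M^{-1} Y M^{-1}, which are similar to a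
    positive definite matrix but in general not symmetric. *)
Lemma spdmx_sqrt N : spdmx N ->
  [/\ spdmx (sqrtmx N), sqrtmx N *m sqrtmx N = N &
    forall A, A \in unitmx ->
      sqrtmx (A *m N *m invmx A) = A *m sqrtmx N *m invmx A].
Proof.
move=> Nspd; have [P Punit [d dgt0 Nd]] := spdmx_diag Nspd.
(* [r] holds the eigenvalues of the root of [N], and [q] those of its fourth root. *)
pose r := map_mx Num.sqrt d; pose q := map_mx Num.sqrt r.
have r_gt0 i : 0 < r 0 i by rewrite mxE sqrtr_gt0.
have q_gt0 i : 0 < q 0 i by rewrite mxE sqrtr_gt0.
have dE : d = map_mx (fun x => x ^+ 2) r.
  by apply/rowP => i; rewrite !mxE sqr_sqrtr // ltW.
have rE : r = map_mx (fun x => x ^+ 2) q.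
  by apply/rowP => i; rewrite [RHS]mxE [q _ _]mxE sqr_sqrtr // ltW.
have NE : sqrtmx N = invmx P *m diag_mx r *m P.
  by rewrite Nd dE sqrtmx_diag.
have [NN _] := principal_sqrtmx_diag Punit r_gt0.
have Nsqrt_sym : sqrtmx N \is symmetricmx.
  by rewrite NE; apply: symmetric_sqrt_diag => //; rewrite -dE -Nd Nspd.1.
split; last 2 first.
- by rewrite NE NN -dE.
(* The conjugate A N A^{-1} is diagonalized by P A^{-1} with the same eigenvalues as [N]. *)
- move=> A Aunit; rewrite NE Nd dE.
  have PAunit : P *m invmx A \in unitmx by rewrite unitmx_mul Punit unitmx_inv.
  have PAV : invmx (P *m invmx A) = A *m invmx P.
    rewrite -[RHS](mulKmx PAunit) !mulmxA mulmxKV // -[_ *m P *m _]mulmxA.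
    by rewrite mulmxV // mulmx1.
  have conjE e : A *m (invmx P *m diag_mx e *m P) *m invmx A
      = invmx (P *m invmx A) *m diag_mx e *m (P *m invmx A).
    by rewrite PAV !mulmxA.
  by rewrite !conjE sqrtmx_diag.
(* The fourth root [G] is symmetric and invertible, so the root of [N] equals G G^T and is congruent
   to the identity, hence positive definite. *)
set G := invmx P *m diag_mx q *m P.
have /symmetricmxP Gsym : G \is symmetricmx.
  by apply: symmetric_sqrt_diag => //; rewrite -rE -NE.
have [GG _] := principal_sqrtmx_diag Punit q_gt0.
have -> : sqrtmx N = G *m 1%:M *m G^T by rewrite Gsym mulmx1 GG -rE.
apply: spdmx_congr spdmx1.
rewrite !unitmx_mul unitmx_inv Punit andbT /= unitmxE det_diag unitfE.
by apply/prodf_neq0 => i _; rewrite gt_eqF.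
Qed.

(** For orthogonal O, the nonnegative trace of (1 - O) H (1 - O^T) expands to 2 tr H - 2 tr (H
    O). *)
Lemma trace_mul_orthogonal_le H O : spdmx H -> O^T *m O = 1%:M ->
  \tr (H *m O) <= \tr H.
Proof.
move=> Hspd OO; have /symmetricmxP Hsym := Hspd.1.
have OO' := mulmx1C OO.
have : 0 <= \tr ((1%:M - O^T)^T *m H *m (1%:M - O^T)) by exact: spdmx_trace_ge0.
rewrite [(_ - _)^T]raddfB /= trmx1 trmxK !mulmxBl !mulmxBr !mul1mx !mulmx1 !raddfB /=.
have -> : \tr (O *m H *m O^T) = \tr H by rewrite mxtrace_mulC mulmxA OO mul1mx.
have -> : \tr (H *m O^T) = \tr (H *m O).
  by rewrite -mxtrace_tr trmx_mul trmxK Hsym mxtrace_mulC.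
rewrite (mxtrace_mulC O H) => ge0.
lra.
Qed.

(* Polar decomposition K = (K K^T)^{1/2} U. *)
Lemma trace_mul_orthogonal_max K : K \in unitmx ->
  [/\ spdmx (K *m K^T),
      forall O, O^T *m O = 1%:M -> \tr (K *m O) <= \tr (sqrtmx (K *m K^T)) &
      exists2 O, O^T *m O = 1%:M & \tr (K *m O) = \tr (sqrtmx (K *m K^T))].
Proof.
move=> Kunit; have KKspd : spdmx (K *m K^T).
  by rewrite -[K in K *m _]mulmx1; apply: spdmx_congr spdmx1.
have [Hspd HH _] := spdmx_sqrt KKspd; set H := sqrtmx _ in Hspd HH *.
have Hunit := spdmx_unit Hspd; have /symmetricmxP Hsym := Hspd.1.
pose U := invmx H *m K; have KE : K = H *m U by rewrite mulKVmx.
have UU : U *m U^T = 1%:M.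
  rewrite trmx_mul trmx_inv Hsym mulmxA -(mulmxA _ K) -HH.
  by rewrite !mulmxA mulVmx // mul1mx mulmxV.
split=> // [O OO|].
  rewrite KE -mulmxA; apply: trace_mul_orthogonal_le => //.
  by rewrite trmx_mul mulmxA -(mulmxA _ U^T) (mulmx1C UU) mulmx1.
exists U^T; first by rewrite trmxK.
by rewrite [X in X *m _]KE -mulmxA UU mulmx1.
Qed.

End PositiveDefinite.

(** * The distance as a minimum over the orthogonal group *)

Theorem proposition1 (R : realType) (n : nat) (M X Y : 'M[R]_n)
  (n_gt0 : (0 < n)%N) (spdM : spdmx M) (spdX : spdmx X) (spdY : spdmx Y) :
  is_minimum
    [set mahalanobis_norm M (sqrtmx X - sqrtmx Y *m O)
       | O in orthogonal_group R n]
    (gbw_dist M X Y).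
Proof.
have [Aspd AA _] := spdmx_sqrt spdX; have [Cspd CC _] := spdmx_sqrt spdY.
have Wspd := spdmx_inv spdM.
rewrite /gbw_dist /mahalanobis_norm.
(* From here on, the two roots and the inverse of [M] enter only as positive definite matrices, the
   roots with squares X and Y. *)
move: (sqrtmx X) (sqrtmx Y) (invmx M) Aspd AA Cspd CC Wspd.
move=> A C W Aspd AA Cspd CC Wspd.
have Aunit := spdmx_unit Aspd; have /symmetricmxP Asym := Aspd.1.
have Cunit := spdmx_unit Cspd; have /symmetricmxP Csym := Cspd.1.
have Wunit := spdmx_unit Wspd; have /symmetricmxP Wsym := Wspd.1.
pose K := A *m W *m C; have Kunit : K \in unitmx.
  by rewrite !unitmx_mul Aunit Wunit.
have [KKspd Kmax [O0 OO0 Keq]] := trace_mul_orthogonal_max Kunit.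
have sqrtE : \tr (sqrtmx (X *m W *m Y *m W)) = \tr (sqrtmx (K *m K^T)).
  have -> : X *m W *m Y *m W = A *m (K *m K^T) *m invmx A.
    by rewrite !trmx_mul Asym Csym Wsym -AA -CC !mulmxA mulmxK.
  have [_ _ ->] := spdmx_sqrt KKspd; last exact: Aunit.
  by rewrite mxtrace_mulC mulmxA mulVmx // mul1mx.
have normE O : O^T *m O = 1%:M ->
    \tr ((A - C *m O)^T *m W *m (A - C *m O))
    = \tr (W *m X) + \tr (W *m Y) - 2 * \tr (K *m O).
  move=> OO; rewrite [(_ - _)^T]raddfB /= trmx_mul Asym Csym.
  rewrite !mulmxBl !mulmxBr !raddfB /=.
  have -> : \tr (A *m W *m A) = \tr (W *m X).
    by rewrite -AA -mulmxA mxtrace_mulC mulmxA.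
  have -> : \tr (O^T *m C *m W *m (C *m O)) = \tr (W *m Y).
    rewrite mxtrace_mulC -CC !mulmxA -(mulmxA _ O) (mulmx1C OO) mulmx1.
    by rewrite mxtrace_mulC !mulmxA.
  (* The two cross terms are traces of mutually transposed matrices, so each contributes tr (K
     O). *)
  have -> : \tr (O^T *m C *m W *m A) = \tr (K *m O).
    by rewrite -mxtrace_tr !trmx_mul trmxK Asym Csym Wsym !mulmxA.
  by rewrite mulmxA -/K; lra.
rewrite sqrtE; split; first by exists O0 => //=; rewrite normE // Keq.
(* The square root is monotone, and the factor -2 turns the upper bound on tr (K O) into a lower
   bound on the norm. *)
move=> _ [O OO <-]; rewrite normE //; apply: ler_wsqrtr.
by rewrite lerD2l lerN2 ler_pM2l ?ltr0n // Kmax.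
Qed.
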